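(* Let $\alpha=\sqrt2$, $A(n)=\lfloor n\alpha\rfloor$ for $n\ge1$, and $\Delta AA=(A(A(n+1))-A(A(n)))_{n\ge1}=1,3,2,2,2,1,3,1,3,2,\dots$. Let $\sigma$ be the morphism on $\{1,2,3\}$ given by $\sigma(1)=123$, $\sigma(2)=1$, $\sigma(3)=121$, and $\delta$ the morphism given by $\delta(1)=13$, $\delta(2)=2$, $\delta(3)=22$. Then $\Delta AA=\delta(x)$, where $x$ is the fixed point of $\sigma$ (starting with $1$).
   Context: $\delta(x)$ denotes the concatenation $\delta(x_1)\delta(x_2)\cdots$; $\Delta AA$ is regarded as an infinite word over the positive integers. *)

(* Defs.v *)
From mathcomp Require Import all_boot all_order all_algebra.
From mathcomp Require Import reals.

Set Implicit Arguments.
Unset Strict Implicit.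
Unset Printing Implicit Defensive.

Import Order.TTheory GRing.Theory Num.Theory.
Local Open Scope ring_scope.

(* An infinite word w_1 w_2 w_3 ... over T is a function [w : nat -> T], with
   the letter w_(i+1) stored at index i. *)

(* f(x_1) f(x_2) ... f(x_n), where [f] gives the values of a morphism of free
   monoids on the letters. *)
Definition image_prefix (T U : Type) (f : T -> seq U) (x : nat -> T) (n : nat)
    : seq U :=
  flatten [seq f a | a <- mkseq x n].

(* y is the infinite word f(x) = f(x_1) f(x_2) ... .  The second clause says
   that this concatenation is infinite, so that it determines y. *)
Definition is_image (T U : Type) (f : T -> seq U) (x : nat -> T) (y : nat -> U)
    : Prop :=
  (forall n : nat,
     mkseq y (size (image_prefix f x n)) = image_prefix f x n) /\
  (forall m : nat, exists n : nat, (m <= size (image_prefix f x n))%N).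

Definition is_fixed_point_from (T : Type) (f : T -> seq T) (a : T)
    (x : nat -> T) : Prop :=
  x 0%N = a /\ is_image f x x.

Inductive letter : Set := L1 | L2 | L3.

Definition sigma (a : letter) : seq letter :=
  match a with
  | L1 => [:: L1; L2; L3]
  | L2 => [:: L1]
  | L3 => [:: L1; L2; L1]
  end.

Definition delta (a : letter) : seq int :=
  match a with
  | L1 => [:: 1; 3]
  | L2 => [:: 2]
  | L3 => [:: 2; 2]
  end.

Definition A (R : realType) (n : int) : int :=
  Num.floor (n%:~R * Num.sqrt (2 : R)).

(* Index i holds the term of rank n = i + 1, as n ranges over n >= 1. *)
Definition DeltaAA (R : realType) (i : nat) : int :=
  let n : int := i.+1%:Z in A R (A R (n + 1)) - A R (A R n).

(* Main.v *)
Require Import Defs.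
From mathcomp Require Import all_boot all_order all_algebra.
From mathcomp Require Import reals.
From mathcomp Require Import ring lra zify.

(** Write s = sqrt 2. If f is the fractional part of n s, then A(A(n)) is
    2n - 1 or 2n - 2 according as f is below or above s/2. Hence the letters of
    Delta AA code the rotation of f by s - 1, and grouping them into the blocks
    13, 2, 22 amounts to coding the map [step] induced by this rotation on the
    interval ]3s/2 - 2, s/2[, cut at 1 - s/2 and 2 - s into pieces labelled
    2, 1, 3. The orientation-reversing contraction [renorm] of this interval, of
    ratio s - 1, fixes the initial point s - 1 and conjugates [step] to the
    first return map on its image; the return words are sigma(2), sigma(1),
    sigma(3), so that the itinerary of s - 1 is fixed by sigma. *)

Set Implicit Arguments.
Unset Strict Implicit.
Unset Printing Implicit Defensive.

Import Order.TTheory GRing.Theory Num.Theory.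
Local Open Scope ring_scope.

Section Words.
Variables (T U : Type).
Implicit Types (f : T -> seq U) (x : nat -> T) (y : nat -> U).

Lemma image_prefixS f x n :
  image_prefix f x n.+1 = image_prefix f x n ++ f (x n).
Proof. by rewrite /image_prefix mkseqS map_rcons flatten_rcons. Qed.

Lemma leq_size_image_prefix f x n :
  (forall a, (0 < size (f a))%N) -> (n <= size (image_prefix f x n))%N.
Proof.
move=> f_gt0; elim: n => // n IHn.
by rewrite image_prefixS size_cat -addn1 leq_add.
Qed.

(** [inv k p] describes the state after [k] letters of [x] have produced [p] letters of [y];
    induction on [k] glues the blocks, and non-empty images make the concatenation infinite. *)
Lemma is_image_by_blocks f x y (inv : nat -> nat -> Prop) :
    (forall a, (0 < size (f a))%N) ->
    inv 0%N 0%N ->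
    (forall k p, inv k p ->
       mkseq (fun i => y (p + i)%N) (size (f (x k))) = f (x k) /\
       inv k.+1 (p + size (f (x k)))%N) ->
  is_image f x y.
Proof.
move=> f_gt0 inv0 invS; split=> [n|m]; last first.
  by exists m; apply: leq_size_image_prefix.
suff [] : mkseq y (size (image_prefix f x n)) = image_prefix f x n /\
          inv n (size (image_prefix f x n)) by [].
elim: n => [//|n [eq_pre /invS[eq_block inv_next]]].
rewrite image_prefixS size_cat; split=> //.
rewrite {1}/mkseq iotaD add0n map_cat -[map y (iota 0 _)]/(mkseq y _) eq_pre.
congr (_ ++ _); rewrite -{2}eq_block /mkseq.
rewrite -[in LHS](addn0 (size (image_prefix _ _ _))).
by rewrite iotaDl -map_comp.
Qed.

End Words.

Lemma size_sigma_gt0 a : (0 < size (sigma a))%N.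
Proof. by case: a. Qed.

(** A common prefix of length n + 1 has a common image of length at least n + 2, because sigma(1)
    has three letters and no image is empty. *)
Lemma sigma_fixed_point_unique x z :
  is_fixed_point_from sigma L1 x -> is_fixed_point_from sigma L1 z -> z =1 x.
Proof.
move=> [x0 [imx _]] [z0 [imz _]].
suff eq_pre n : mkseq z n = mkseq x n.
  move=> k; have := congr1 (nth L1 ^~ k) (eq_pre k.+1).
  by rewrite !nth_mkseq.
elim: n => // -[|n] IHn; first by rewrite /mkseq /= x0 z0.
have eq_im : image_prefix sigma z n.+1 = image_prefix sigma x n.+1.
  by rewrite /image_prefix IHn.
have size_gt : (n.+2 <= size (image_prefix sigma x n.+1))%N.
  elim: {IHn eq_im} n => [|n IHn]; first by rewrite /image_prefix /= x0.
  rewrite image_prefixS size_cat -[n.+3]addn1.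
  exact: leq_add IHn (size_sigma_gt0 _).
have eq_long : mkseq z (size (image_prefix sigma x n.+1)) =
               mkseq x (size (image_prefix sigma x n.+1)).
  by rewrite imx -eq_im imz.
have := congr1 (take n.+2) eq_long.
by rewrite /mkseq -!map_take !take_iota (minn_idPl size_gt).
Qed.

Section Dynamics.
Variable R : realType.
Local Notation s := (Num.sqrt (2 : R)).
Implicit Types f : R.

Lemma sqrt2_sqr : s * s = 2.
Proof. by rewrite -expr2 sqr_sqrtr. Qed.

Lemma sqrt2_bounds : 7 / 5 < s < 71 / 50.
Proof.
have s_ge0 : 0 <= s by apply: sqrtr_ge0.
by apply/andP; split; have := sqrt2_sqr; nra.
Qed.

(** If a is nonzero in 2 a^2 = b^2, the 2-adic valuation is odd on the left and even on the
    right. *)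
Lemma sqrt2_irrational (a b : int) : a%:~R * s = b%:~R -> a = 0.
Proof.
move=> eq_ab; have {eq_ab} : (2 * (a * a))%:~R = (b * b)%:~R :> R.
  by rewrite !rmorphM /= -eq_ab mulrACA sqrt2_sqr mulrC.
move=> /intr_inj /(congr1 absz); rewrite !abszM => eq_ab.
apply/eqP; rewrite -absz_eq0; apply: contraT => a_neq0.
have a_gt0 : (0 < `|a|)%N by rewrite lt0n.
have b_gt0 : (0 < `|b|)%N by move: eq_ab; case: `|b|%N => //; lia.
have := congr1 (odd \o logn 2) eq_ab.
by rewrite /= !lognM ?muln_gt0 ?a_gt0 //= !oddD !addbb.
Qed.

Definition code f : letter :=
  if f < 1 - s / 2 then L2 else if f < 2 - s then L1 else L3.

(** Adding 2 s - 3 is two rotations by s - 1 with one wrap modulo 1; the return time is thus the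
    length of the delta block. *)
Definition step f : R :=
  if f < 1 - s / 2 then f + s - 1 else f + 2 * s - 3.

Definition renorm f : R := 2 - s - (s - 1) * f.

(** Such an [f] is the fractional part of n s, as the interval lies inside ]0, 1[. *)
Definition rot_pt (n : int) f : Prop :=
  (exists m : int, f = n%:~R * s - m%:~R) /\ 3 * s / 2 - 2 < f < s / 2.

Variant piece_spec f : letter -> R -> Prop :=
| Piece2 of 3 * s / 2 - 2 < f < 1 - s / 2 : piece_spec f L2 (f + s - 1)
| Piece1 of 1 - s / 2 < f < 2 - s : piece_spec f L1 (f + 2 * s - 3)
| Piece3 of 2 - s < f < s / 2 : piece_spec f L3 (f + 2 * s - 3).

(** No such point sits on a cut: f = 2 - s or f = 1 - s/2 would make (n + 1) s or (2 n + 1) s an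
    integer. *)
Lemma pieceP (n : int) f :
  0 < n -> rot_pt n f -> piece_spec f (code f) (step f).
Proof.
move=> n_gt0 [[m fE] /andP[f_gt f_lt]]; rewrite /code /step.
have s_bds := sqrt2_bounds; case: (ltgtP f (1 - s / 2)) => f1.
- by constructor; rewrite f_gt.
- case: (ltgtP f (2 - s)) => f2; constructor; rewrite ?f1 ?f2 //.
  suff : n + 1 = 0 by lia.
  apply: (@sqrt2_irrational _ (m + 2)); rewrite !rmorphD /=.
  by rewrite fE in f2; lra.
- suff : 2 * n + 1 = 0 by lia.
  apply: (@sqrt2_irrational _ (2 * m + 2)); rewrite !rmorphD !rmorphM /=.
  by rewrite fE in f1; lra.
Qed.

Lemma rot_pt_step (n : int) f : 0 < n -> rot_pt n f ->
  rot_pt (n + (size (delta (code f)))%:Z) (step f).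
Proof.
move=> n_gt0 nf; have [[m fE] _] := nf; have := sqrt2_bounds.
case: (pieceP n_gt0 nf) => f_bds s_bds /=; split; try by lra.
- by exists (m + 1); rewrite fE !rmorphD /=; ring.
- by exists (m + 3); rewrite fE !rmorphD /=; ring.
- by exists (m + 3); rewrite fE !rmorphD /=; ring.
Qed.

(** [renorm] sends the whole interval into the piece labelled 1, which is why each sigma(a) starts
    with 1; s^2 = 2 then closes the conjugacy. *)
Lemma renorm_block (n : int) f : 0 < n -> rot_pt n f ->
  let l := size (sigma (code f)) in
  mkseq (fun i => code (iter i step (renorm f))) l = sigma (code f) /\
  iter l step (renorm f) = renorm (step f).
Proof.
move=> n_gt0 nf.
have ss := sqrt2_sqr; have /andP[s_gt s_lt] := sqrt2_bounds.
have code2 g : g < 1 - s / 2 -> code g = L2 /\ step g = g + s - 1.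
  by rewrite /code /step => ->.
have code1 g : 1 - s / 2 <= g < 2 - s -> code g = L1 /\ step g = g + 2 * s - 3.
  by case/andP; rewrite /code /step leNgt => /negPf -> ->.
have code3 g : 2 - s <= g -> code g = L3 /\ step g = g + 2 * s - 3.
  move=> g_ge; have /negPf g1 : ~~ (g < 1 - s / 2) by rewrite -leNgt; lra.
  by rewrite /code /step g1 ltNge g_ge.
rewrite /mkseq; case: (pieceP n_gt0 nf) => /andP[f_gt f_lt] /=.
- have [|-> ->] := code1 (renorm f); first by rewrite /renorm; nra.
  by split=> //; rewrite /renorm; nra.
- have [|-> ->] := code1 (renorm f); first by rewrite /renorm; nra.
  have [|-> ->] := code2 (renorm f + 2 * s - 3); first by rewrite /renorm; nra.
  have [|-> ->] := code3 (renorm f + 2 * s - 3 + s - 1).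
    by rewrite /renorm; nra.
  by split=> //; rewrite /renorm; nra.
- have [|-> ->] := code1 (renorm f); first by rewrite /renorm; nra.
  have [|-> ->] := code2 (renorm f + 2 * s - 3); first by rewrite /renorm; nra.
  have [|-> ->] := code1 (renorm f + 2 * s - 3 + s - 1).
    by rewrite /renorm; nra.
  by split=> //; rewrite /renorm; nra.
Qed.

Lemma A_eq (n m : int) : 0 <= n%:~R * s - m%:~R < 1 -> A R n = m.
Proof. by move=> ?; apply: floor_def; rewrite rmorphD /=; lra. Qed.

(* Multiplying f = n s - m by s gives m s = 2 n - f s. *)
Lemma A_dual (n m k : int) :
  k%:~R - 1 < (n%:~R * s - m%:~R) * s <= k%:~R -> A R m = 2 * n - k.
Proof.
have -> : (n%:~R * s - m%:~R) * s = 2 * n%:~R - m%:~R * s.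
  by rewrite mulrBl -mulrA sqrt2_sqr mulrC.
by move=> ?; apply: A_eq; rewrite rmorphB rmorphM /=; lra.
Qed.

(** Since s/2 = 1/s, here 0 < f s < 1 for f = n s - m, so [A_dual] applies with k = 1. *)
Lemma AA_low (n m : int) :
  0 < n%:~R * s - m%:~R < s / 2 -> A R (A R n) = 2 * n - 1.
Proof.
move=> nm; have ss := sqrt2_sqr; have s_bds := sqrt2_bounds.
rewrite (@A_eq n m); last by lra.
by apply: A_dual; move: (n%:~R * s - m%:~R) nm => f /andP[? ?]; nra.
Qed.

(** Here 1 < f s < s < 2, hence k = 2. *)
Lemma AA_high (n m : int) :
  s / 2 < n%:~R * s - m%:~R < 1 -> A R (A R n) = 2 * n - 2.
Proof.
move=> nm; have ss := sqrt2_sqr; have s_bds := sqrt2_bounds.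
rewrite (@A_eq n m); last by lra.
by apply: A_dual; move: (n%:~R * s - m%:~R) nm => f /andP[? ?]; nra.
Qed.

(** Each block leads from a point below s/2 to another. Two consecutive low points give the
    difference 2, low then high gives 1, high then low gives 3. *)
Lemma DeltaAA_block p f : rot_pt p.+1%:Z f ->
  mkseq (fun i => DeltaAA R (p + i)) (size (delta (code f))) = delta (code f).
Proof.
move=> nf; have [[m fE] _] := nf; have s_bds := sqrt2_bounds.
have DE i :
    DeltaAA R (p + i) =
    A R (A R (p.+1%:Z + i.+1%:Z)) - A R (A R (p.+1%:Z + i%:Z)).
  by rewrite /DeltaAA; congr (A R (A R _) - A R (A R _)); lia.
rewrite /mkseq; case: (pieceP _ nf) => //= /andP[f_gt f_lt]; rewrite !DE {DE}.
all: move: (p.+1%:Z) fE => n fE.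
- rewrite (@AA_low (n + 0) m) ?(@AA_low (n + 1) (m + 1));
    [by congr [:: _]; ring | by rewrite !rmorphD /=; lra ..].
- rewrite (@AA_low (n + 0) m) ?(@AA_high (n + 1) (m + 1))
    ?(@AA_low (n + 2) (m + 3));
    [by congr [:: _; _]; ring | by rewrite !rmorphD /=; lra ..].
(* For the letter 3 the wrap modulo 1 comes at the first rotation, so the integer part grows by 2,
   then by 1. *)
- rewrite (@AA_low (n + 0) m) ?(@AA_low (n + 1) (m + 2))
    ?(@AA_low (n + 2) (m + 3));
    [by congr [:: _; _]; ring | by rewrite !rmorphD /=; lra ..].
Qed.

Definition orbit k : R := iter k step (s - 1).

Lemma rot_pt_orbit0 : rot_pt 1 (orbit 0).
Proof.
have s_bds := sqrt2_bounds; split; last by rewrite /orbit /=; lra.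
by exists 1; rewrite mul1r.
Qed.

Lemma rot_pt_orbit k : exists2 n : int, 0 < n & rot_pt n (orbit k).
Proof.
elim: k => [|k [n n_gt0 nf]]; first by exists 1 => //; exact: rot_pt_orbit0.
by eexists; last exact: rot_pt_step nf; lia.
Qed.

Lemma itinerary_fixed : is_fixed_point_from sigma L1 (code \o orbit).
Proof.
have ss := sqrt2_sqr; have s_bds := sqrt2_bounds.
split.
  rewrite /orbit /code /=.
  have /negPf -> : ~~ (s - 1 < 1 - s / 2) by rewrite -leNgt; lra.
  by have -> : s - 1 < 2 - s by lra.
(* Time [p] on the orbit is the renormalized copy of time [k]; this holds at the start because
   [renorm] fixes s - 1. *)
apply: (is_image_by_blocks (inv := fun k p => orbit p = renorm (orbit k))).
- exact: size_sigma_gt0.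
- by rewrite /orbit /renorm /=; nra.
move=> k p eq_p; have [n n_gt0 nf] := rot_pt_orbit k.
have [eq_block eq_next] := renorm_block n_gt0 nf.
have orbitD i : orbit (p + i) = iter i step (renorm (orbit k)).
  by rewrite -eq_p /orbit addnC iterD.
split; last by rewrite orbitD.
by rewrite -[RHS]eq_block; apply: eq_mkseq => i /=; rewrite orbitD.
Qed.

Lemma DeltaAA_image : is_image delta (code \o orbit) (DeltaAA R).
Proof.
(* After [p] letters of Delta AA the next rank is p + 1, so [orbit k] has to be the fractional part
   of (p + 1) s. *)
apply: (is_image_by_blocks (inv := fun k p => rot_pt p.+1%:Z (orbit k))).
- by case.
- exact: rot_pt_orbit0.
move=> k p nf; split; first exact: DeltaAA_block.
have := rot_pt_step _ nf; rewrite -PoszD addSn; exact.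
Qed.

End Dynamics.

Theorem theorem7 (R : realType) :
  exists x : nat -> letter,
    [/\ is_fixed_point_from sigma L1 x,
        forall z : nat -> letter, is_fixed_point_from sigma L1 z -> z =1 x
      & is_image delta x (DeltaAA R)].
Proof.
exists (@code R \o @orbit R); split.
- exact: itinerary_fixed.
- by move=> z; apply: sigma_fixed_point_unique; apply: itinerary_fixed.
- exact: DeltaAA_image.
Qed.
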